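(* Let $H$ be an infinite dimensional Hilbert space. For every $K\geq 5$, there exist closed subspaces $L_1,\dots,L_K\subset H$ with $\bigcap_{k\in[K]}L_k=\{0\}$ and with the following properties: (i) there is a starting point $z_0\in H$ and a sequence of indices $k_1,k_2,\dots\in[K]$ containing each of the numbers $1,\dots,K$ infinitely often such that the sequence of iterates defined by $z_n=P(L_{k_n})z_{n-1}$, $n\ge1$, does not converge in norm; (ii) the subspaces $L_4,L_5,\dots,L_K$ are pairwise orthogonal; in particular, $L_1^{\perp}+\dots+L_K^{\perp}=H$.
   Context: $[K]=\{1,\dots,K\}$. For a closed subspace $X$ of $H$, $P(X)$ is the orthogonal projection of $H$ onto $X$, and $X^\perp$ is its orthogonal complement in $H$. *)

(* Defs.v *)
From HB Require Import structures.
From mathcomp Require Import all_boot all_order all_algebra.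
From mathcomp Require Import all_classical all_reals all_analysis.
From mathcomp Require Import complex.

Set Implicit Arguments.
Unset Strict Implicit.
Unset Printing Implicit Defensive.

Import Order.TTheory GRing.Theory Num.Theory.
Import numFieldNormedType.Exports.

Local Open Scope classical_set_scope.
Local Open Scope ring_scope.

(* The scalar field of a Hilbert space is either R or R[i] = C; the first is
   equipped with the trivial conjugation, so that a "hermitian" form over it is
   a symmetric bilinear form. *)
Inductive scalars := RealScalars | ComplexScalars.

Definition scalar_field (R : realType) (s : scalars) : numFieldType :=
  match s with
  | RealScalars => R
  | ComplexScalars => R[i]
  end.

Definition scalar_conj (R : realType) (s : scalars) :
    scalar_field R s -> scalar_field R s :=
  match s return scalar_field R s -> scalar_field R s with
  | RealScalars => fun x => x
  | ComplexScalars => @conjc R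
  end.

Definition finite_dimensional (F : numFieldType) (H : lmodType F) : Prop :=
  exists (n : nat) (e : 'I_n -> H),
    forall x : H, exists c : 'I_n -> F, x = \sum_(i < n) c i *: e i.

Definition closed_subspace (F : numFieldType) (H : normedModType F)
    (X : set H) : Prop :=
  GRing.submod_closed (mem X) /\ closed X.

Section InnerProduct.
Context (F : numFieldType) (theta : F -> F) (H : normedModType F).
Variable dot : {dot H for theta}.

Definition orthocompl (X : set H) : set H :=
  [set y | forall x, X x -> dot y x = 0].

(* P(X)z is the point p of X such that z - p is orthogonal to X. It is unique
   when X is a subspace, and exists when moreover X is closed and H complete;
   the default value 0 of xget only matters outside of this case. *)
Definition orthoproj (X : set H) (z : H) : H :=
  xget 0 [set p | X p /\ orthocompl X (z - p)].

(* z_0 = z0 and z_n = P(L_{k_n}) z_{n-1} for n >= 1; since k starts at 0, the index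
   k_n is k (n - 1). *)
Fixpoint proj_iterates (I : Type) (L : I -> set H) (k : nat -> I) (z0 : H)
    (n : nat) : H :=
  if n is m.+1 then orthoproj (L (k m)) (proj_iterates L k z0 m) else z0.

End InnerProduct.

Definition set_sum (F : numFieldType) (H : lmodType F) (I : finType)
    (X : I -> set H) : set H :=
  [set x | exists2 y : I -> H, (forall i, X i (y i)) & x = \sum_i y i].

(* Main.v *)
Require Import Defs.
From HB Require Import structures.
From mathcomp Require Import all_boot all_order all_algebra.
From mathcomp Require Import all_classical all_reals all_analysis.
From mathcomp Require Import ring lra zify.
From mathcomp Require Import complex.

Set Implicit Arguments.
Unset Strict Implicit.
Unset Printing Implicit Defensive.

Import Order.TTheory GRing.Theory Num.Theory.
Import numFieldNormedType.Exports.

Local Open Scope classical_set_scope.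
Local Open Scope ring_scope.

(** The divergent iterates carry a vector along an orthonormal sequence e_0, e_1, ...
with summable losses. They come within 1/4 of every e_i, hence do not converge.

The vector is carried from e_i to e_(i+1), up to any prescribed error, by a product
of three projections acting on a block: the span of e_i, e_(i+1) and infinitely many
fresh orthonormal vectors (transfer_word). Let E be the plane of e_i and e_(i+1).
Projecting onto successive lines of E, each at a small angle with the preceding one,
turns e_i into e_(i+1) and loses little norm if there are many lines (quarter_turn).
All these projections onto lines come from one positive contraction A on a space X
that contains E, because powers of the compression P_E A^t can approximate any of
them, depending on the time t (approx_rejections). Here A damps orthonormal vectors
g_0, g_1, ... at rates q_0, q_1, ..., and the projection of g_k to E is a small multiple
of the unit normal n_k of the k-th line. Successive multiples decrease rapidly and
successive rates increase rapidly. At a time t of order 1 / q_k the vectors with smaller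
rates are not yet damped, and those with larger rates are almost orthogonal to E; so
P_E A^t fixes the k-th line nearly and shrinks n_k by a factor slightly smaller than 1,
and a high power of it is nearly the projection onto the line. Finally A^t = (P_X P_Y)^t
on X for a subspace Y that is tilted with respect to X (iter_copy_tilt_coproj).

It remains to glue the blocks. Neighbouring blocks share one vector e_(i+1), which
belongs to E and X in both blocks. So the closed span of all the planes E is a single
subspace that acts correctly in every block (residual_orthogonal), and likewise the
closed span of all the X. The subspaces Y of neighbouring blocks cannot be merged.
Those of the odd blocks are merged into one subspace, and those of the even blocks,
which are pairwise orthogonal, are distributed cyclically among the remaining K - 3
subspaces. This makes the last K - 3 subspaces pairwise orthogonal. As K - 3 >= 2,
two of them meet in 0 only, and each lies in the orthogonal complement of the other,
so that their orthogonal complements add up to H. *)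

(** * Elementary estimates and sequences *)

Lemma sum_ord_single (V : nmodType) N k (kN : (k < N)%N) (f : 'I_N -> V) :
  (forall i : 'I_N, val i != k -> f i = 0) -> \sum_(i < N) f i = f (Ordinal kN).
Proof.
by move=> f0; rewrite (bigD1 (Ordinal kN)) //= big1 ?addr0.
Qed.

Lemma geometric_small (R : realType) (a e : R) :
  0 < a -> a <= 1 -> 0 < e -> exists s, (1 - a) ^+ s.+1 <= e.
Proof.
move=> a0 a1 e0; have h : `|1 - a| < 1 by rewrite ger0_norm; lra.
have /cvgrPdist_le/(_ _ e0) [s _ /(_ s.+1 (leqnSn s))] := cvg_expr h.
rewrite /= sub0r normrN => hs; exists s.
exact: le_trans (ler_norm _) hs.
Qed.

Lemma archi_small (R : realType) (a e : R) :
  0 <= a -> 0 < e -> exists2 m, (0 < m)%N & a / m%:R <= e.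
Proof.
move=> a0 e0; exists (Num.bound (a / e)).+1 => //.
rewrite ler_pdivrMr // mulrC -ler_pdivrMr //; apply: ltW.
apply: lt_le_trans (archi_boundP _) _; first by rewrite divr_ge0 // ltW.
by rewrite ler_nat.
Qed.

Lemma bernoulli_le (R : realType) (y : R) N : 0 <= y <= 1 -> 1 - (1 - y) ^+ N <= N%:R * y.
Proof.
move=> /andP[y0 y1]; elim: N => [|N IH]; first by rewrite expr0 subrr mul0r.
have : 0 <= (1 - y) ^+ N <= 1 by rewrite exprn_ge0 ?exprn_ile1 //; lra.
rewrite exprS -natr1 mulrDl mul1r => /andP[p0 p1]; nra.
Qed.

(** The mean value theorem, applied to the cosine and then to the sine. *)
Lemma one_sub_cos_le (R : realType) (x : R) : 0 <= x -> 1 - cos x <= x ^+ 2.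
Proof.
move=> x0.
have [c /itvP c0x] : exists2 c, c \in `[0, x] & cos x - cos 0 = - sin c * (x - 0).
  apply: (@MVT_segment R cos (fun y => - sin y)) => //.
  by apply: continuous_subspaceT => y; exact: continuous_cos.
have [d _] : exists2 d, d \in `[0, c] & sin c - sin 0 = cos d * (c - 0).
  apply: (@MVT_segment R sin cos) => //; first by rewrite c0x.
  by apply: continuous_subspaceT => y; exact: continuous_sin.
rewrite sin0 cos0 !subr0 => -> h.
rewrite -opprB h mulNr opprK -mulrA expr2 mulrA; apply: ler_wpM2r => //.
apply: le_trans (_ : 1 * c <= x); last by rewrite mul1r c0x.
by apply: ler_wpM2r; [rewrite c0x|exact: cos_le1].
Qed.

Lemma unbounded_infinite_set (A : set nat) :
  (forall N, exists2 n, (N <= n)%N & A n) -> infinite_set A.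
Proof.
move=> Aub /finite_seqP[s As]; have [n sn] := Aub (\max_(x <- s) x).+1.
rewrite As /= => ns; move: sn; rewrite ltnNge.
by move/negP; apply; exact: leq_bigmax_seq.
Qed.

Lemma foldl_nseq T U (f : T -> U -> T) z x k :
  foldl f z (nseq k x) = iter k (f^~ x) z.
Proof. by elim: k z => [//|k IH] z; rewrite iterSr -IH. Qed.

Lemma foldl_mapE T U W (f : T -> W -> T) (h : U -> W) z s :
  foldl f z (map h s) = foldl (fun y x => f y (h x)) z s.
Proof. by elim: s z => //=. Qed.

Section Concatenation.
Variables (T : Type) (ws : nat -> seq T).
Hypothesis ws_neq0 : forall i, (0 < size (ws i))%N.

Definition concat m := flatten (map ws (iota 0 m)).

Lemma concatD m n : concat (m + n) = concat m ++ flatten (map ws (iota m n)).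
Proof. by rewrite /concat iotaD map_cat flatten_cat. Qed.

Lemma concatS m : concat m.+1 = concat m ++ ws m.
Proof. by rewrite -addn1 concatD /= cats0. Qed.

Lemma size_concat m : (m <= size (concat m))%N.
Proof.
elim: m => [//|m IH]; rewrite concatS size_cat -addn1.
exact: leq_add.
Qed.

(** The words being nonempty, the first n + 1 of them have more than n letters in total,
so the letter number n of the infinite word can be read off there. *)
Lemma concat_sequence : exists ks : nat -> T,
  forall m, mkseq ks (size (concat m)) = concat m.
Proof.
have [x0 _] : exists x0 : T, True by case: (ws 0) (ws_neq0 0) => [//|x s _]; exists x.
exists (fun n => nth x0 (concat n.+1) n) => m.
apply: (@eq_from_nth _ x0); rewrite size_mkseq // => n nm.
rewrite nth_mkseq //; have nn := size_concat n.+1.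
have [mn|mn] := leqP n.+1 m.
  by rewrite -(subnKC mn) concatD nth_cat nn.
by rewrite -(subnKC (ltnW mn)) concatD nth_cat nm.
Qed.

End Concatenation.

(** * Real inner product spaces *)

Section RealInnerProduct.
Variables (R : realType) (V : lmodType R) (dot : {dot V for idfun}).
Implicit Types (u v w x y z : V) (a c e : R).

Local Notation "''[' u , v ]" := (dot u v) : ring_scope.

Lemma rdotC u v : '[u, v] = '[v, u].
Proof. by rewrite hermC mul1r. Qed.

Lemma rdotBl u v w : '[u - v, w] = '[u, w] - '[v, w].
Proof. by rewrite linearBl. Qed.

Lemma rdotBr u v w : '[w, u - v] = '[w, u] - '[w, v].
Proof. by rewrite linearBr. Qed.

Lemma rdotDl u v w : '[u + v, w] = '[u, w] + '[v, w].
Proof. by rewrite linearDl. Qed.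

Lemma rdotDr u v w : '[w, u + v] = '[w, u] + '[w, v].
Proof. by rewrite linearDr. Qed.

Lemma rdotNl u w : '[- u, w] = - '[u, w].
Proof. by rewrite linearNl. Qed.

Lemma rdotNr u w : '[w, - u] = - '[w, u].
Proof. by rewrite linearNr. Qed.

Lemma rdotZl a u w : '[a *: u, w] = a * '[u, w].
Proof. by rewrite linearZl_LR. Qed.

Lemma rdotZr a u w : '[w, a *: u] = a * '[w, u].
Proof. by rewrite linearZr_LR. Qed.

Lemma rdot0l w : '[0, w] = 0.
Proof. by rewrite linear0l. Qed.

Lemma rdot0r w : '[w, 0] = 0.
Proof. by rewrite linear0r. Qed.

Lemma rdot_suml I (r : seq I) (P : pred I) (F : I -> V) w :
  '[\sum_(i <- r | P i) F i, w] = \sum_(i <- r | P i) '[F i, w].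
Proof. exact: linear_sumlz. Qed.

Lemma rdot_sumr I (r : seq I) (P : pred I) (F : I -> V) w :
  '[w, \sum_(i <- r | P i) F i] = \sum_(i <- r | P i) '[w, F i].
Proof. exact: linear_sumr. Qed.

Definition rdotE := (rdotNl, rdotNr, rdotDl, rdotDr, rdotZl, rdotZr, rdot0l, rdot0r).

Lemma rdot_ge0 u : 0 <= '[u, u].
Proof.
have [->|/neq0_dnorm_gt0/ltW//] := eqVneq u 0.
by rewrite rdot0l.
Qed.

Lemma CauchySchwarz u v : '[u, v] ^+ 2 <= '[u, u] * '[v, v].
Proof.
have [->|v0] := eqVneq v 0; first by rewrite !rdotE expr0n mulr0.
have a0 : 0 < '[v, v] by exact: neq0_dnorm_gt0.
have := rdot_ge0 ('[v, v] *: u - '[u, v] *: v).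
rewrite !rdotE (rdotC v u) => h.
rewrite -subr_ge0 -(pmulr_rge0 _ a0); congr (_ <= _): h.
by ring.
Qed.

Definition nrm u := Num.sqrt '[u, u].

Lemma nrm_ge0 u : 0 <= nrm u. Proof. exact: sqrtr_ge0. Qed.

Lemma sqr_nrm u : nrm u ^+ 2 = '[u, u].
Proof. by rewrite sqr_sqrtr // rdot_ge0. Qed.

Lemma nrm_le u c : 0 <= c -> '[u, u] <= c ^+ 2 -> nrm u <= c.
Proof.
by move=> c0 h; rewrite -(ler_pXn2r (n := 2)) ?nnegrE ?nrm_ge0 ?sqr_nrm.
Qed.

Lemma nrmZ a u : nrm (a *: u) = `|a| * nrm u.
Proof. by rewrite /nrm !rdotE mulrA -expr2 sqrtrM ?sqr_ge0 // sqrtr_sqr. Qed.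

Lemma dot_le_nrm u v : '[u, v] <= nrm u * nrm v.
Proof.
have := CauchySchwarz u v; rewrite -!sqr_nrm -exprMn -ler_sqrt ?sqr_ge0 //.
rewrite !sqrtr_sqr [X in _ <= X]ger0_norm; last by rewrite mulr_ge0 ?nrm_ge0.
exact/le_trans/ler_norm.
Qed.

Lemma ler_nrmD u v : nrm (u + v) <= nrm u + nrm v.
Proof.
apply: nrm_le; first by rewrite addr_ge0 ?nrm_ge0.
rewrite !rdotE (rdotC v u) sqrrD !sqr_nrm.
have := dot_le_nrm u v; lra.
Qed.

Lemma nrmN u : nrm (- u) = nrm u.
Proof. by rewrite -scaleN1r nrmZ normrN1 mul1r. Qed.

Lemma nrm0 : nrm 0 = 0.
Proof. by rewrite /nrm rdot0l sqrtr0. Qed.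

Lemma ler_nrm_tri v u w : nrm (u - w) <= nrm (u - v) + nrm (v - w).
Proof. by rewrite -{1}[u](subrK v) -addrA ler_nrmD. Qed.

Lemma ler_nrm_sum I (r : seq I) (F : I -> V) :
  nrm (\sum_(i <- r) F i) <= \sum_(i <- r) nrm (F i).
Proof.
elim: r => [|i r IH]; first by rewrite !big_nil nrm0.
by rewrite !big_cons (le_trans (ler_nrmD _ _)) // lerD2l.
Qed.

Lemma norm_dot_le u v : `|'[u, v]| <= nrm u * nrm v.
Proof.
rewrite ler_norml dot_le_nrm andbT lerNl -(nrmN u) -mulN1r -rdotZl scaleN1r.
exact: dot_le_nrm.
Qed.

(** Orthogonal projection onto the range of P, without naming that range. *)
Definition projector (P : V -> V) := forall u v, '[u - P u, P v] = 0.

Lemma nrm_projector P u : projector P -> nrm (P u) <= nrm u.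
Proof.
move=> PP; apply: nrm_le; first exact: nrm_ge0.
rewrite sqr_nrm.
have := PP u u; have := rdot_ge0 (u - P u).
rewrite !rdotE (rdotC (P u) u); lra.
Qed.

Definition orthonormal_upto N (g : nat -> V) :=
  forall i j, (i < N)%N -> (j < N)%N -> '[g i, g j] = (i == j)%:R.

Definition span_proj N (g : nat -> V) v := \sum_(k < N) '[v, g k] *: g k.

(** For orthonormal g, this multiplies the g k component by 1 - mu k and fixes the
orthogonal complement of the family. *)
Definition damp N (g : nat -> V) (mu : nat -> R) v :=
  v - \sum_(k < N) (mu k * '[v, g k]) *: g k.

Lemma span_projB N g u v :
  span_proj N g (u - v) = span_proj N g u - span_proj N g v.
Proof.
rewrite /span_proj -sumrB; apply: eq_bigr => k _.
by rewrite rdotBl scalerBl.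
Qed.

Lemma dampB N g mu u v : damp N g mu (u - v) = damp N g mu u - damp N g mu v.
Proof.
rewrite /damp [in RHS]opprD [RHS]addrACA -[in RHS]opprD; congr (_ - _).
rewrite -sumrB; apply: eq_bigr => k _.
by rewrite rdotBl mulrBr scalerBl.
Qed.

Section OrthonormalFamily.
Variables (N : nat) (g : nat -> V).
Hypothesis g_on : orthonormal_upto N g.

Lemma dot_comb (a : nat -> R) k :
  (k < N)%N -> '[\sum_(i < N) a i *: g i, g k] = a k.
Proof.
move=> kN; rewrite rdot_suml (sum_ord_single kN) => [|i ik]; rewrite rdotE g_on //.
  by rewrite eqxx mulr1.
by rewrite (negPf ik) mulr0.
Qed.

Lemma dot_comb2 (a c : nat -> R) :
  '[\sum_(i < N) a i *: g i, \sum_(i < N) c i *: g i] = \sum_(i < N) a i * c i.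
Proof.
rewrite rdot_sumr; apply: eq_bigr => k _.
by rewrite rdotE dot_comb // mulrC.
Qed.

Lemma projector_span : projector (span_proj N g).
Proof.
move=> u v; rewrite /span_proj rdot_sumr big1 // => k _.
rewrite !rdotE (dot_comb (fun i => '[u, g i])) //.
exact: subrr.
Qed.

Lemma projector_cospan : projector (fun v => v - span_proj N g v).
Proof.
move=> u v; rewrite subKr rdotBr [X in _ - X](_ : _ = '[span_proj N g u, v]).
  by rewrite subrr.
rewrite (dot_comb2 (fun i => '[u, g i]) (fun i => '[v, g i])) rdot_suml.
by apply: eq_bigr => k _; rewrite rdotE (rdotC v).
Qed.

Lemma damp_dot mu v k :
  (k < N)%N -> '[damp N g mu v, g k] = (1 - mu k) * '[v, g k].
Proof.
by move=> kN; rewrite rdotBl (dot_comb (fun k => mu k * '[v, g k])) // mulrBl mul1r.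
Qed.

Lemma damp_damp mu nu v :
  damp N g mu (damp N g nu v) = damp N g (fun k => 1 - (1 - mu k) * (1 - nu k)) v.
Proof.
rewrite {1}/damp {2}/damp -addrA -opprD; congr (_ - _).
rewrite -big_split /=; apply: eq_bigr => k _.
by rewrite damp_dot // -scalerDl; congr (_ *: _); ring.
Qed.

Lemma nrm_damp mu v :
  (forall k, (k < N)%N -> 0 <= mu k <= 1) -> nrm (damp N g mu v) <= nrm v.
Proof.
move=> mu01; apply: nrm_le; first exact: nrm_ge0.
rewrite sqr_nrm -subr_ge0.
pose x (k : nat) := mu k * '[v, g k].
rewrite (_ : _ - _ = \sum_(k < N) (x k * '[v, g k] *+ 2 - x k * x k)).
  apply: sumr_ge0 => k _; rewrite /x.
  rewrite (_ : _ - _ = (mu k * (2 - mu k)) * '[v, g k] ^+ 2); last by ring.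
  have := mu01 k (ltn_ord k) => /andP[? ?].
  by rewrite mulr_ge0 ?sqr_ge0 // mulr_ge0 //; lra.
rewrite sumrB sumrMnl -(dot_comb2 x x) /damp.
rewrite (_ : \sum_(k < N) x k * '[v, g k] = '[v, \sum_(k < N) x k *: g k]).
  rewrite rdotBl !rdotBr (rdotC (\sum_(k < N) _) v) mulr2n.
  by ring.
by rewrite rdot_sumr; apply: eq_bigr => k _; rewrite rdotE.
Qed.

End OrthonormalFamily.

End RealInnerProduct.

(** * Turning a plane by compressed powers of a damping *)

Section Block.
Variables (R : realType) (V : lmodType R) (dot : {dot V for idfun}).
Variable b : nat -> V.
Hypothesis b_on : forall i j, dot (b i) (b j) = (i == j)%:R.
Implicit Types (u v w x y z n : V) (a c e : R).

Local Notation "''[' u , v ]" := (dot u v) : ring_scope.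
Local Notation nrm := (nrm dot).
Local Notation damp := (damp dot).
Local Notation rdotC := (rdotC dot).

Lemma b_upto N : orthonormal_upto dot N b.
Proof. by move=> i j _ _; exact: b_on. Qed.

(** The plane in which b 0 is to be turned into b 1. *)
Definition plane_proj := span_proj dot 2 b.

Lemma plane_projE v : plane_proj v = '[v, b 0] *: b 0 + '[v, b 1] *: b 1.
Proof. by rewrite /plane_proj /span_proj !big_ord_recl big_ord0 addr0. Qed.

Lemma projector_plane : projector dot plane_proj.
Proof. exact/projector_span/b_upto. Qed.

Lemma nrm_plane_proj v : nrm (plane_proj v) <= nrm v.
Proof. exact/nrm_projector/projector_plane. Qed.

Lemma plane_projB u v : plane_proj (u - v) = plane_proj u - plane_proj v.
Proof. exact: span_projB. Qed.

Lemma plane_projD u v : plane_proj (u + v) = plane_proj u + plane_proj v.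
Proof. by rewrite !plane_projE !rdotE !scalerDl addrACA. Qed.

Lemma plane_projZ a v : plane_proj (a *: v) = a *: plane_proj v.
Proof. by rewrite !plane_projE !rdotE scalerDr !scalerA. Qed.

Lemma plane_proj_sum I (r : seq I) (F : I -> V) :
  plane_proj (\sum_(k <- r) F k) = \sum_(k <- r) plane_proj (F k).
Proof.
by apply: (big_morph plane_proj plane_projD); rewrite plane_projE !rdotE !scale0r addr0.
Qed.

Lemma plane_proj_dotC u v : '[plane_proj u, v] = '[u, plane_proj v].
Proof. by rewrite !plane_projE !rdotE (rdotC v) (rdotC (b 1) v) mulrC (mulrC '[u, b 1]). Qed.

Lemma plane_proj_b0 : plane_proj (b 0) = b 0.
Proof. by rewrite plane_projE !b_on /= scale1r scale0r addr0. Qed.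

Lemma plane_proj_b1 : plane_proj (b 1) = b 1.
Proof. by rewrite plane_projE !b_on /= scale1r scale0r add0r. Qed.

Lemma plane_proj_id v : plane_proj (plane_proj v) = plane_proj v.
Proof. by rewrite [LHS]plane_projE !plane_proj_dotC plane_proj_b0 plane_proj_b1 -plane_projE. Qed.

Lemma plane_proj_b j : (2 <= j)%N -> plane_proj (b j) = 0.
Proof. by case: j => [|[|j]] // _; rewrite plane_projE !b_on !scale0r addr0. Qed.

(** With 1 - exp (- q t) as damping coefficients, the damping for t units of time is
the t-th power of the damping for one unit. *)
Definition rate (q : nat -> R) (t k : nat) : R := 1 - expR (- (q k * t%:R)).

Definition pulse N g q t v := plane_proj (damp N g (rate q t) (plane_proj v)).

Definition reject v n := v - '[v, n] *: n.

Lemma rate01 q t k : 0 <= q k -> 0 <= rate q t k <= 1.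
Proof.
move=> q0; rewrite subr_ge0 expR_le1 oppr_le0 mulr_ge0 //=.
by rewrite gerBl expR_ge0.
Qed.

Lemma rate_le q t k : rate q t k <= q k * t%:R.
Proof. by have := expR_ge1Dx (- (q k * t%:R)); rewrite /rate; lra. Qed.

(** All maps being nonexpansive, the errors of the single steps at most add up. *)
Lemma fold_close (A B : nat -> V -> V) (s : seq nat) d z z' :
  0 <= d ->
  (forall t x y, nrm (A t x - A t y) <= nrm (x - y)) ->
  (forall t x, nrm (B t x) <= nrm x) ->
  (forall t x, t \in s -> nrm (A t x - B t x) <= d * nrm x) ->
  nrm (foldl (fun z t => A t z) z s - foldl (fun z t => B t z) z' s)
    <= nrm (z - z') + (size s)%:R * d * nrm z'.
Proof.
move=> d0 A1 B1; elim: s z z' => [|t s IH] z z' AB /=.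
  by rewrite !mul0r addr0.
apply: (le_trans (IH _ _ _)) => [u x us|]; first by rewrite AB // inE us orbT.
have h1 : nrm (A t z - B t z') <= nrm (z - z') + d * nrm z'.
  apply: le_trans (ler_nrm_tri dot (A t z') _ _) _.
  by rewrite lerD ?A1 ?AB // mem_head.
have h2 : (size s)%:R * d * nrm (B t z') <= (size s)%:R * d * nrm z'.
  by rewrite ler_wpM2l ?B1 // mulr_ge0.
rewrite -natr1; lra.
Qed.

(** Only the component along n changes, and it is multiplied by 1 - c at each step. *)
Lemma iter_shrink n c s z : '[n, n] = 1 ->
  iter s (fun v => v - (c * '[v, n]) *: n) z = z - ((1 - (1 - c) ^+ s) * '[z, n]) *: n.
Proof.
move=> n1; elim: s => [|s IH] /=; first by rewrite expr0 subrr mul0r scale0r subr0.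
rewrite IH !rdotE n1 mulr1 -addrA -opprD -scalerDl exprS.
by congr (_ - _ *: _); ring.
Qed.

(** The basis vectors b j with M <= j are still free. The last clause says that every
vector n of the plane is the projection of some vector orthogonal to all the g k: this
is what allows one to prescribe the direction of the projection of the next g. *)
Definition damping_data M N g :=
  [/\ (2 <= M)%N, orthonormal_upto dot N g,
      forall k j, (k < N)%N -> (M <= j)%N -> '[g k, b j] = 0
    & forall n, plane_proj n = n -> exists v, [/\ plane_proj v = n,
        forall k, (k < N)%N -> '[v, g k] = 0 &
        forall j, (M <= j)%N -> '[v, b j] = 0]].

(** With v above n and orthogonal to the family, the new vector is e v + b M, normalized.
The free vector b M makes the factor of n as small as desired. It also preserves the
lifting clause, since subtracting a multiple of b M from a lift makes it orthogonal to
the new vector and does not move its projection to the plane. *)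
Lemma damping_data_extend M N g n e : damping_data M N g ->
  plane_proj n = n -> '[n, n] = 1 -> 0 < e -> e <= 1 ->
  exists g' a, [/\ damping_data M.+1 N.+1 g',
    forall k, (k < N)%N -> g' k = g k, plane_proj (g' N) = a *: n & 0 < a <= e].
Proof.
move=> [M2 g_on gb lift] nE n1 e0 e1.
have [v [vn vg vb]] := lift _ nE.
pose d := e ^+ 2 * '[v, v] + 1; pose c : R := (Num.sqrt d)^-1.
have d1 : 1 <= d by rewrite lerDr mulr_ge0 ?sqr_ge0 ?rdot_ge0.
have d0 : 0 < d by apply: lt_le_trans d1.
have c0 : 0 < c by rewrite invr_gt0 sqrtr_gt0.
have cd : c ^+ 2 * d = 1.
  by rewrite exprVn sqr_sqrtr ?(ltW d0) // mulVf // gt_eqF.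
have c1 : c <= 1.
  by rewrite invf_le1 ?sqrtr_gt0 // -sqrtr1 ler_sqrt // ltW.
pose h := c *: (e *: v + b M).
pose g' k := if k == N then h else g k.
have g'N : g' N = h by rewrite /g' eqxx.
have g'k k : (k < N)%N -> g' k = g k by move=> kN; rewrite /g' ltn_eqF.
have gh k : (k < N)%N -> '[g k, h] = 0.
  by move=> kN; rewrite /h !rdotE gb // (rdotC _ v) vg // mulr0 addr0 mulr0.
have hh : '[h, h] = 1.
  rewrite /h !rdotE (rdotC _ v) vb // b_on eqxx mulr0 !add0r addr0.
  by apply: etrans cd; rewrite /d mulr1n; ring.
have bh : '[b M, h] = c.
  by rewrite /h !rdotE (rdotC _ v) vb // b_on eqxx mulr0 add0r mulr1.
have hE : plane_proj h = (c * e) *: n.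
  by rewrite /h plane_projZ plane_projD plane_projZ vn plane_proj_b // addr0 scalerA.
have hb j : (M < j)%N -> '[h, b j] = 0.
  by move=> Mj; rewrite /h !rdotE vb ?(ltnW Mj) // b_on ltn_eqF // mulr0 addr0 mulr0.
clearbody g' h.
exists g', (c * e); split; [split|exact: g'k|by rewrite g'N| ].
- exact: leqW.
- move=> i j; rewrite !ltnS => iN jN.
  move: iN jN; rewrite (leq_eqVlt i) (leq_eqVlt j) => /predU1P[->|iN] /predU1P[->|jN].
  + by rewrite g'N hh eqxx.
  + by rewrite g'N g'k // rdotC gh // gtn_eqF.
  + by rewrite g'N g'k // gh // ltn_eqF.
  + by rewrite !g'k // g_on.
- move=> k j; rewrite ltnS leq_eqVlt => /predU1P[->|kN] Mj.
    by rewrite g'N hb.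
  by rewrite g'k // gb // ltnW.
- move=> m mE; have [w [wm wg wb]] := lift _ mE.
  exists (w - ('[w, h] / c) *: b M); split.
  + by rewrite plane_projB plane_projZ plane_proj_b // scaler0 subr0.
  + move=> k; rewrite ltnS leq_eqVlt => /predU1P[->|kN].
      by rewrite g'N !rdotE bh divfK ?subrr // gt_eqF.
    by rewrite g'k // !rdotE wg // (rdotC (b M)) gb // mulr0 subr0.
  + by move=> j Mj; rewrite !rdotE wb ?(ltnW Mj) // b_on ltn_eqF // mulr0 subr0.
- by rewrite mulr_gt0 //=; apply: ler_piMl => //; exact: ltW.
Qed.

Lemma pulseB N g q t u v : pulse N g q t (u - v) = pulse N g q t u - pulse N g q t v.
Proof. by rewrite /pulse plane_projB dampB plane_projB. Qed.

Lemma nrm_pulse N g q t v : orthonormal_upto dot N g -> (forall k, 0 <= q k) ->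
  nrm (pulse N g q t v) <= nrm v.
Proof.
move=> g_on q0; apply: le_trans (nrm_plane_proj _) _; apply: le_trans (nrm_plane_proj v).
by apply: nrm_damp => // k _; exact: rate01.
Qed.

Lemma nrm_shrink n a v : '[n, n] = 1 -> 0 <= a <= 1 ->
  nrm (v - (a * '[v, n]) *: n) <= nrm v.
Proof.
move=> n1 a01.
have n_on : orthonormal_upto dot 1 (fun=> n) by case=> [|//] [|//] _ _; rewrite eqxx.
have := nrm_damp n_on v (mu := fun=> a) (fun _ _ => a01).
by rewrite /damp big_ord_recl big_ord0 addr0.
Qed.

(** Slowing down the damping and waiting longer has no effect. *)
Lemma rate_scale q m t k : (0 < m)%N ->
  rate (fun k => q k / m%:R) (m * t) k = rate q t k.
Proof.
move=> m0; rewrite /rate natrM mulrA divfK //.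
by rewrite pnatr_eq0 -lt0n.
Qed.

Lemma plane_proj_foldl_reject ns z :
  plane_proj z = z -> (forall n, n \in ns -> plane_proj n = n) ->
  plane_proj (foldl reject z ns) = foldl reject z ns.
Proof.
elim: ns z => [//|n ns IH] z zE nsE /=; apply: IH => [|m mns].
  by rewrite /reject plane_projB plane_projZ zE nsE ?mem_head.
by rewrite nsE // inE mns orbT.
Qed.

Lemma nrm_foldl_reject ns z : (forall n, n \in ns -> '[n, n] = 1) ->
  nrm (foldl reject z ns) <= nrm z.
Proof.
elim: ns z => [//|n ns IH] z ns1 /=; apply: le_trans (IH _ _) _ => [m mns|].
  by rewrite ns1 // inE mns orbT.
by have := @nrm_shrink n 1 z (ns1 n (mem_head _ _)); rewrite mul1r ler01 lexx; apply.
Qed.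

Lemma nrm1 n : '[n, n] = 1 -> nrm n = 1.
Proof. by rewrite /nrm => ->; rewrite sqrtr1. Qed.

Lemma nrm_coef_le c x y z : '[y, y] = 1 -> nrm z <= 1 -> `|c| <= 1 ->
  nrm ((c * '[x, y]) *: z) <= nrm x.
Proof.
move=> y1 z1 c1; rewrite nrmZ normrM -[leRHS]mulr1.
apply: ler_pM => //; first exact: nrm_ge0.
rewrite -[leRHS]mul1r; apply: ler_pM => //.
by apply: le_trans (norm_dot_le _ _ _) _; rewrite (nrm1 y1) mulr1.
Qed.

(** By induction on the list of normals. The new vector g' N gets so small a component in
the plane that it hardly affects the finite product already constructed. Then the old
rates are divided by a large m, the old times multiplied by m, and the new rate is 1: the
old pulses are unchanged, whereas at time 1 only g' N is damped noticeably. So a pulse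
at time 1 shrinks the component along n by a fixed factor 1 - c and changes little else;
enough of them nearly remove this component. *)
Lemma approx_rejections (ns : seq V) e : 0 < e ->
  (forall n, n \in ns -> plane_proj n = n /\ '[n, n] = 1) ->
  exists M N g q ts, [/\ damping_data M N g, forall k, 0 < q k,
    ns != [::] -> 1%N \in ts &
    nrm (foldl (fun z t => pulse N g q t z) (b 0) ts - foldl reject (b 0) ns) <= e].
Proof.
elim/last_ind: ns e => [|ns n IH] e e0 nsE.
  exists 2, 0%N, (fun=> 0), (fun=> 1), [::]; split => //=; last first.
    by rewrite subrr nrm0 ltW.
  split => // n nE; exists n; split => // j j2.
  by rewrite -nE plane_proj_dotC plane_proj_b // rdot0r.
have e4 : 0 < e / 4 by lra.
have [|M [N [g [q [ts [gdata q0 _ ts_close]]]]]] := IH _ e4.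
  by move=> m mns; apply: nsE; rewrite mem_rcons inE mns orbT.
have [nE n1] := nsE n (eqbRL (mem_rcons _ _ _) (mem_head _ _)).
(* eta bounds the component of g' N in the plane. *)
pose S := size ts.
have [eta [eta0 eta1 eta_small]] : exists eta : R,
    [/\ 0 < eta, eta <= 1 & S%:R * eta <= e / 4].
  pose x : R := e / 4 / S.+1%:R.
  have S1 : 0 < S.+1%:R :> R by [].
  exists (Num.min 1 x); split.
  - by rewrite lt_min ltr01 divr_gt0.
  - by rewrite ge_min lexx.
  - apply: (@le_trans _ _ (S.+1%:R * x)); last by rewrite /x mulrC divfK // gt_eqF.
    apply: ler_pM => //; first by rewrite le_min ler01 divr_ge0 // ltW.
      by rewrite ler_nat.
    by rewrite ge_min lexx orbT.
have [g' [a [g'data g'g g'N /andP[a0 a_eta]]]] := damping_data_extend gdata nE n1 eta0 eta1.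

(* A pulse at time 1 multiplies the component along n by nearly 1 - c. *)
pose gam : R := 1 - expR (- 1).
have gam0 : 0 < gam by rewrite subr_gt0 expR_lt1 oppr_lt0.
have gam1 : gam <= 1 by rewrite gerBl expR_ge0.
pose c : R := gam * a ^+ 2.
have a1 : a <= 1 by lra.
have c0 : 0 < c by rewrite mulr_gt0 // exprn_gt0.
have c1 : c <= 1 by rewrite mulr_ile1 ?(ltW gam0) ?sqr_ge0 // expr_le1 // ltW.
have [s s_small] := geometric_small c0 c1 e4.
pose Q : R := \sum_(k < N) q k.
have Q0 : 0 <= Q by apply: sumr_ge0 => k _; exact: ltW.
have [m m0 m_small] := archi_small (mulr_ge0 (ler0n R s.+1) Q0) e4.
pose q' k : R := if k == N then 1 else q k / m%:R.
have q'0 k : 0 < q' k.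
  by rewrite /q'; case: eqP => // _; rewrite divr_gt0 // ltr0n.
have q'ge0 k : 0 <= q' k := ltW (q'0 k).
have g'on : orthonormal_upto dot N.+1 g' by case: g'data.
have gon : orthonormal_upto dot N g by case: gdata.
exists M.+1, N.+1, g', q', (map (muln m) ts ++ nseq s.+1 1%N).
split=> // [_|]; first by rewrite mem_cat /= mem_head orbT.
rewrite foldl_cat foldl_rcons foldl_mapE.
set u := foldl _ _ _ in ts_close; set k0 := foldl reject _ _ in ts_close *.
set w := foldl _ (b 0) ts.
have b01 : nrm (b 0) = 1 by rewrite nrm1 // b_on.
have k0E : plane_proj k0 = k0.
  apply: plane_proj_foldl_reject => [|x xns]; first exact: plane_proj_b0.
  by case: (nsE x) => //; rewrite mem_rcons inE xns orbT.
have k01 : nrm k0 <= 1.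
  rewrite -b01; apply: nrm_foldl_reject => x xns.
  by case: (nsE x) => //; rewrite mem_rcons inE xns orbT.
have pulse'E t x : pulse N.+1 g' q' t x =
  plane_proj (plane_proj x - \sum_(k < N) (rate q' t k * '[plane_proj x, g k]) *: g k)
   - (rate q' t N * '[plane_proj x, g' N] * a) *: n.
  rewrite /pulse /damp big_ord_recr /= opprD addrA plane_projB plane_projZ g'N scalerA.
  congr (plane_proj (_ - _) - _); apply: eq_bigr => k _.
  by rewrite g'g.
have w_close : nrm (w - u) <= e / 4.
  have := @fold_close (fun t => pulse N.+1 g' q' (m * t))
    (fun t => pulse N g q t) ts a (b 0) (b 0).
  rewrite subrr nrm0 add0r b01 mulr1 => /(_ (ltW a0)) h.
  apply: le_trans (h _ _ _) _.
  - by move=> t x y; rewrite -pulseB nrm_pulse.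
  - by move=> t x; rewrite nrm_pulse // => k; exact: ltW.
  - move=> t x _; rewrite pulse'E /pulse /damp.
    rewrite (eq_bigr (fun k : 'I_N => (rate q t k * '[plane_proj x, g k]) *: g k)); last first.
      move=> k _; rewrite -(rate_scale q t k m0) /rate /q' ltn_eqF //.
    rewrite addrC addKr nrmN mulrC -scalerA nrmZ (gtr0_norm a0).
    rewrite ler_wpM2l ?(ltW a0) //; apply: le_trans (nrm_plane_proj x).
    have /andP[r0 r1] := rate01 (m * t) (q'ge0 N).
    by apply: nrm_coef_le; rewrite ?g'on ?eqxx ?nrm1 ?ger0_norm.
  - by apply: le_trans eta_small; rewrite ler_wpM2l.
(* The ideal pulse at time 1, in which only g' N is damped. *)
pose B x := plane_proj x - (c * '[x, n]) *: n.
have BE k : iter k B k0 = k0 - ((1 - (1 - c) ^+ k) * '[k0, n]) *: n.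
  rewrite -iter_shrink //; elim: k => //= k ->; rewrite {1}/B; congr (_ - _).
  by rewrite iter_shrink // plane_projB plane_projZ k0E nE.
have := @fold_close (fun t => pulse N.+1 g' q' t) (fun=> B)
  (nseq s.+1 1%N) (Q / m%:R) w k0.
rewrite [foldl _ k0 _]foldl_nseq BE size_nseq => h.
apply: le_trans (ler_nrm_tri _ (k0 - ((1 - (1 - c) ^+ s.+1) * '[k0, n]) *: n) _ _) _.
have -> : e = (e / 4 + e / 4 + e / 4) + e / 4 by field.
apply: lerD; last first.
  rewrite /reject opprB addrC addrA subrK -scalerBl -{1}['[k0, n]]mul1r -mulrBl subKr.
  rewrite nrmZ (nrm1 n1) mulr1 normrM.
  have p0 : 0 <= (1 - c) ^+ s.+1 by rewrite exprn_ge0 // subr_ge0.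
  rewrite (ger0_norm p0) -[leRHS]mulr1; apply: ler_pM => //.
  by apply: le_trans (norm_dot_le _ _ _) _; rewrite (nrm1 n1) mulr1.
apply: le_trans (h _ _ _ _) _.
- by rewrite divr_ge0.
- by move=> t x y; rewrite -pulseB nrm_pulse.
- move=> _ x; rewrite /B.
  have := nrm_shrink (plane_proj x) n1 (a := c).
  rewrite (ltW c0) c1 plane_proj_dotC nE => /(_ isT) hx.
  exact: le_trans hx (nrm_plane_proj x).
- move=> t x /nseqP[-> _]; rewrite pulse'E /B.
  have -> : rate q' 1 N * '[plane_proj x, g' N] * a = c * '[x, n].
    rewrite plane_proj_dotC g'N rdotZr /rate /q' eqxx mulr1 -/gam /c; ring.
  rewrite plane_projB plane_proj_id plane_proj_sum opprB addrA subrK addrC addKr nrmN.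
  apply: le_trans (ler_nrm_sum _ _ _) _.
  rewrite /Q mulr_suml mulr_suml; apply: ler_sum => k _.
  rewrite plane_projZ -scalerA nrmZ ger0_norm; last by case/andP: (rate01 1 (q'ge0 k)).
  apply: ler_pM; rewrite ?nrm_ge0 //; first by case/andP: (rate01 1 (q'ge0 k)).
    by apply: le_trans (rate_le _ _ _) _; rewrite /q' ltn_eqF // mulr1.
  apply: le_trans (nrm_plane_proj x); rewrite -[X in X *: _]mul1r.
  apply: nrm_coef_le; rewrite ?gon ?eqxx ?normr1 //.
  by apply: le_trans (nrm_plane_proj _) _; rewrite nrm1 ?gon ?eqxx.
- apply: lerD; first by apply: le_trans (ler_nrm_tri _ u _ _) _; exact: lerD.
  apply: le_trans m_small; rewrite mulrA -[leRHS]mulr1.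
  apply: ler_pM => //; [|exact: nrm_ge0].
  by rewrite divr_ge0 // mulr_ge0.
Qed.
(** With N equal angles x = pi / (2 N), the final vector is cos x ^+ N *: b 1, and
1 - cos x ^+ N <= N x ^ 2, which is of order 1 / N. *)
Lemma quarter_turn e : 0 < e -> exists ns : seq V, [/\ ns != [::],
  forall n, n \in ns -> plane_proj n = n /\ '[n, n] = 1 &
  nrm (foldl reject (b 0) ns - b 1) <= e].
Proof.
move=> e0; pose h : R := pi / 2.
have h0 : 0 <= h by rewrite divr_ge0 ?pi_ge0.
have [N N0 hN] := archi_small (sqr_ge0 h) e0.
have Nr : N%:R != 0 :> R by rewrite pnatr_eq0 -lt0n.
pose x := h / N%:R.
have x0 : 0 <= x by rewrite divr_ge0.
pose w j := cos (j%:R * x) *: b 0 + sin (j%:R * x) *: b 1.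
pose n j := - sin (j%:R * x) *: b 0 + cos (j%:R * x) *: b 1.
exists (map n (iota 1 N)); split.
- by rewrite -size_eq0 size_map size_iota -lt0n.
- move=> m /mapP[j _ ->]; split.
    by rewrite /n plane_projD !plane_projZ plane_proj_b0 // plane_proj_b1.
  rewrite /n !rdotE !b_on /=; apply: etrans (cos2Dsin2 (j%:R * x)).
  by ring.
have stepw a j : reject (a *: w j) (n j.+1) = (a * cos x) *: w j.+1.
  rewrite /reject /w /n; set y := j.+1%:R * x.
  have -> : j%:R * x = y - x by rewrite /y -natr1; ring.
  rewrite cosB sinB !rdotE !b_on /= !scalerDr !scalerA opprD addrACA -!scalerBl.
  have := cos2Dsin2 y; set C := cos y; set S := sin y => CS.
  rewrite !mulr1n !mulr0n !mulr0 !mulr1 !addr0 !add0r.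
  have -> : (C * cos x + S * sin x) * - S + (S * cos x - C * sin x) * C =
      - (sin x * (C ^+ 2 + S ^+ 2)) by ring.
  rewrite CS mulr1.
  congr (_ *: _ + _ *: _).
    by rewrite mulrN; ring.
  by ring.
have turn j : foldl reject (b 0) (map n (iota 1 j)) = cos x ^+ j *: w j.
  elim: j => [|j IH].
    by rewrite /w mul0r cos0 sin0 scale0r addr0 !scale1r.
  by rewrite -[j.+1]addn1 iotaD map_cat foldl_cat IH /= add1n stepw addn1 exprSr.
rewrite turn /w mulrC divfK // cos_pihalf sin_pihalf scale0r add0r scale1r.
rewrite -[X in _ - X]scale1r -scalerBl nrmZ (nrm1 (b_on 1 1)) mulr1.
have c1 : cos x <= 1 by exact: cos_le1.
have c0 : 0 <= cos x.
  apply: cos_ge0_pihalf; apply/andP; split; first by apply: le_trans x0; rewrite oppr_le0.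
  by rewrite ler_pdivrMr ?ltr0n // ler_peMr // ler1n.
rewrite distrC ger0_norm ?subr_ge0 ?exprn_ile1 //.
have := @bernoulli_le R (1 - cos x) N; rewrite subKr subr_ge0 c1 gerBl c0 => /(_ isT) hb.
apply: le_trans hb _; apply: le_trans hN.
apply: le_trans (ler_wpM2l _ (one_sub_cos_le x0)) _; first exact: ler0n.
by rewrite /x expr_div_n [in X in X <= _]expr2 expr2 invfM mulrC -!mulrA mulVf // mulr1.
Qed.

(** * The damping as a product of two projections *)

Section Realization.
Variables (M N : nat) (g : nat -> V) (q : nat -> R).
Hypothesis gdata : damping_data M N g.
Hypothesis q0 : forall k, 0 < q k.

Let g_on : orthonormal_upto dot N g. Proof. by case: gdata. Qed.

(** X is the orthogonal complement of the vectors copy k, and Y that of the vectors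
tilt k. *)
Definition copy k := b (M + k).
Let al k : R := Num.sqrt (1 - expR (- q k)).
Let be k : R := Num.sqrt (expR (- q k)).
Definition tilt k := al k *: g k - be k *: copy k.

Let al2 k : al k ^+ 2 = 1 - expR (- q k).
Proof. by rewrite sqr_sqrtr // subr_ge0 expR_le1 oppr_le0 ltW. Qed.

Let be2 k : be k ^+ 2 = expR (- q k).
Proof. by rewrite sqr_sqrtr // expR_ge0. Qed.

Lemma copy_on : orthonormal_upto dot N copy.
Proof. by move=> i j _ _; rewrite b_on eqn_add2l. Qed.

Lemma dot_copy k j : (k < N)%N -> '[g k, copy j] = 0.
Proof. by move=> kN; case: gdata => _ _ gb _; rewrite gb // leq_addr. Qed.

Lemma tilt_on : orthonormal_upto dot N tilt.
Proof.
move=> i j iN jN.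
rewrite /tilt !rdotE (rdotC (copy i)) !dot_copy // g_on // copy_on //.
have [->|_] := eqVneq i j; last by rewrite mulr0n; ring.
rewrite mulr1n; apply: (@etrans _ _ (al j ^+ 2 + be j ^+ 2)); first by ring.
by rewrite al2 be2 subrK.
Qed.

Definition copy_coproj v := v - span_proj dot N copy v.
Definition tilt_coproj v := v - span_proj dot N tilt v.

(** For v in X, the product of v with tilt k is al k times its product with g k; the
projection back to X removes the copies, and the coefficient al k ^+ 2 of g k is left. *)
Lemma copy_tilt_coproj v : (forall k, (k < N)%N -> '[v, copy k] = 0) ->
  copy_coproj (tilt_coproj v) = damp N g (rate q 1) v.
Proof.
move=> vc.
have tE k : (k < N)%N -> '[v, tilt k] = al k * '[v, g k].
  by move=> kN; rewrite !rdotE vc // mulr0 subr0.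
have YE : tilt_coproj v = v - \sum_(k < N) (al k * '[v, g k]) *: tilt k.
  by congr (_ - _); apply: eq_bigr => k _; rewrite tE.
have Yc j : (j < N)%N -> '[tilt_coproj v, copy j] = al j * '[v, g j] * be j.
  move=> jN; rewrite YE rdotBl vc // sub0r rdot_suml.
  rewrite (sum_ord_single jN) => [|k kj]; rewrite !rdotE dot_copy // copy_on //.
    by rewrite eqxx mulr0 mulr1 add0r mulrN opprK.
  by rewrite (negPf kj) !mulr0 subrr mulr0.
rewrite /copy_coproj /span_proj.
rewrite (eq_bigr (fun k : 'I_N => (al k * '[v, g k] * be k) *: copy k)); last first.
  by move=> k _; rewrite Yc.
rewrite YE /damp -addrA -opprD -big_split; congr (_ - _); apply: eq_bigr => k _ /=.
rewrite /tilt scalerBr !scalerA subrK; congr (_ *: _).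
by rewrite mulrAC -expr2 al2 /rate mulr1.
Qed.

Lemma damp_copy mu v : (forall k, (k < N)%N -> '[v, copy k] = 0) ->
  forall k, (k < N)%N -> '[damp N g mu v, copy k] = 0.
Proof.
move=> vc k kN; rewrite rdotBl vc // rdot_suml big1 ?subrr // => j _.
by rewrite rdotE dot_copy // mulr0.
Qed.

Lemma iter_copy_tilt_coproj t v : (forall k, (k < N)%N -> '[v, copy k] = 0) ->
  iter t (fun v => copy_coproj (tilt_coproj v)) v = damp N g (rate q t) v.
Proof.
move=> vc; elim: t => [|t IH] /=.
  rewrite /damp big1 ?subr0 // => k _.
  by rewrite /rate mulr0 oppr0 expR0 subrr mul0r scale0r.
rewrite IH copy_tilt_coproj; last exact: damp_copy.
rewrite damp_damp // /damp; congr (_ - _); apply: eq_bigr => k _.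
congr ((_ * _) *: _); rewrite /rate !subKr -expRD; congr (1 - expR _).
by rewrite -natr1; ring.
Qed.

Lemma plane_proj_copy v k : '[plane_proj v, copy k] = 0.
Proof.
have M2 : (2 <= M)%N by case: gdata.
by rewrite plane_proj_dotC plane_proj_b ?rdot0r // ltn_addr.
Qed.

(** The letters 0, 1 and 2 stand for the projections onto E, X and Y. *)
Definition letter l := nth tilt_coproj [:: plane_proj; copy_coproj] l.
Definition pulse_word t := 0%N :: flatten (nseq t [:: 2; 1]) ++ [:: 0%N].

Lemma foldl_pulse_word t v :
  foldl (fun z l => letter l z) v (pulse_word t) = pulse N g q t v.
Proof.
have iterE z : foldl (fun z l => letter l z) z (flatten (nseq t [:: 2; 1])) =
    iter t (fun v => copy_coproj (tilt_coproj v)) z.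
  by elim: t z => [//|t IH] z; rewrite iterSr -IH.
rewrite /pulse_word -cat1s catA !foldl_cat [X in _ X (_ t _)]/= iterE.
by rewrite iter_copy_tilt_coproj // => k _; exact: plane_proj_copy.
Qed.

Lemma foldl_pulse_words ts v :
  foldl (fun z l => letter l z) v (flatten (map pulse_word ts)) =
  foldl (fun z t => pulse N g q t z) v ts.
Proof.
elim: ts v => [//|t ts IH] v.
by rewrite -cat1s map_cat flatten_cat foldl_cat IH [flatten _]cats0 foldl_pulse_word.
Qed.

Lemma projector_letter l : projector dot (letter l).
Proof.
case: l => [|[|l]]; first exact: projector_plane.
  exact/projector_cospan/copy_on.
by rewrite /letter /= nth_nil; exact/projector_cospan/tilt_on.
Qed.

Lemma copy_coproj_plane v : copy_coproj (plane_proj v) = plane_proj v.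
Proof.
rewrite /copy_coproj /span_proj big1 ?subr0 // => k _.
by rewrite plane_proj_copy scale0r.
Qed.

End Realization.

(** The projections number 0 and 1 fix b 0 and b 1: this is what allows consecutive
blocks to share a vector. *)
Lemma transfer_word e : 0 < e ->
  exists (P : nat -> V -> V) (s : seq nat), [/\ forall l, projector dot (P l),
    forall l j, (l < 2)%N -> (j < 2)%N -> P l (b j) = b j,
    forall l, (l \in s) = (l < 3)%N &
    nrm (foldl (fun z l => P l z) (b 0) s - b 1) <= e].
Proof.
move=> e0; have e2 : 0 < e / 2 by lra.
have [ns [ns0 nsE ns_close]] := quarter_turn e2.
have [M [N [g [q [ts [gdata q0 /(_ ns0) ts1 ts_close]]]]]] := approx_rejections e2 nsE.
exists (letter M N g q), (flatten (map pulse_word ts)); split.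

- by move=> l; exact: (projector_letter gdata q0).
- have plane_projj j : (j < 2)%N -> plane_proj (b j) = b j.
    by case: j => [|[|//]] _; [exact: plane_proj_b0|exact: plane_proj_b1].
  case=> [|[|l]] j // _ /plane_projj // bE.
  by rewrite -bE; exact: (copy_coproj_plane gdata).
- move=> l; apply/idP/idP.
    case/flattenP => _ /mapP[t _ ->]; rewrite inE mem_cat mem_seq1.
    case/orP => [/eqP-> //|/orP[|/eqP-> //]].
    by case/flattenP => _ /nseqP[-> _]; rewrite !inE => /orP[] /eqP->.
  move=> l3; apply/flattenP; exists (pulse_word 1); first exact: map_f.
  by case: l l3 => [|[|[|]]].
- rewrite foldl_pulse_words //.
  have -> : e = e / 2 + e / 2 by field.
  apply: le_trans (ler_nrm_tri _ (foldl reject (b 0) ns) _ _) _.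
  exact: lerD.
Qed.

End Block.

(** * Finite real sequences as polynomials *)

Section PolyInnerProduct.
Variable R : realType.
Implicit Types p q : {poly R}.

(** A polynomial stands for the finite sequence of its coefficients; the monomials are
the standard orthonormal basis. *)
Definition dotp p q : R := \sum_(i < size p) p`_i * q`_i.

Lemma dotpE n p q : (size p <= n)%N -> dotp p q = \sum_(i < n) p`_i * q`_i.
Proof.
move=> pn; rewrite /dotp (big_ord_widen _ (fun i => p`_i * q`_i) pn) big_mkcond.
apply: eq_bigr => i _; case: ltnP => // pi.
by rewrite nth_default // mul0r.
Qed.

Lemma dotpC p q : dotp p q = dotp q p.
Proof.
rewrite (dotpE _ (leq_maxl (size p) (size q))) (dotpE _ (leq_maxr (size p) (size q))).
by apply: eq_bigr => i _; rewrite mulrC.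
Qed.

Fact dotp_linearl q : linear_for *%R (dotp^~ q).
Proof.
move=> a p1 p2.
pose n := maxn (size (a *: p1 + p2)) (maxn (size p1) (size p2)).
rewrite (@dotpE n) ?leq_maxl // (@dotpE n p1) ?(@dotpE n p2); last 2 first.
- by rewrite /n !leq_max leqnn !orbT.
- by rewrite /n !leq_max leqnn !orbT.
rewrite mulr_sumr -big_split; apply: eq_bigr => i _ /=.
by rewrite coefD coefZ mulrDl mulrA.
Qed.

Fact dotp_zmodl q : zmod_morphism (dotp^~ q).
Proof. by move=> p1 p2; rewrite addrC -scaleN1r dotp_linearl mulN1r addrC. Qed.

Fact dotp_scall q : scalable_for *%R (dotp^~ q).
Proof.
move=> a p; rewrite -[a *: p]addr0 dotp_linearl (_ : dotp 0 q = 0) ?addr0 //.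
by rewrite /dotp size_poly0 big_ord0.
Qed.

Fact dotp_zmodr p : zmod_morphism (dotp p).
Proof. by move=> q1 q2; rewrite !(dotpC p) dotp_zmodl. Qed.

Fact dotp_scalr p : scalable_for (idfun \; *%R) (dotp p).
Proof. by move=> a q; rewrite !(dotpC p) dotp_scall. Qed.

Fact dotp_herm p q : dotp p q = (-1) ^+ false * idfun (dotp q p).
Proof. by rewrite expr0 mul1r dotpC. Qed.

Fact dotp_gt0 p : p != 0 -> 0 < dotp p p.
Proof.
move=> p0; rewrite /dotp.
have kp : ((size p).-1 < size p)%N by rewrite prednK // lt0n size_poly_eq0.
rewrite (bigD1 (Ordinal kp)) //=; apply: ltr_wpDr.
  by apply: sumr_ge0 => i _; rewrite -expr2 sqr_ge0.
by rewrite -expr2 exprn_even_gt0 //= -lead_coefE lead_coef_eq0.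
Qed.

HB.instance Definition _ := @isBilinear.Build R {poly R} {poly R} R *%R (idfun \; *%R)
  dotp dotp_zmodl dotp_zmodr dotp_scall dotp_scalr.
HB.instance Definition _ := @isHermitianSesquilinear.Build R {poly R} false idfun
  dotp dotp_herm.
HB.instance Definition _ := @isDotProduct.Build R {poly R} dotp dotp_gt0.

Lemma dotp_coef p i : dotp p 'X^i = p`_i.
Proof.
have [pi|ip] := ltnP i (size p); last first.
  rewrite nth_default // /dotp big1 // => k _.
  by rewrite coefXn ltn_eqF ?mulr0 // (leq_trans (ltn_ord k)).
rewrite /dotp (sum_ord_single pi) => [|k ki]; rewrite coefXn ?eqxx ?mulr1 //.
by rewrite (negPf ki) mulr0.
Qed.

Lemma dotp_Xn i j : dotp 'X^i 'X^j = (i == j)%:R.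
Proof. by rewrite dotp_coef coefXn eq_sym. Qed.

End PolyInnerProduct.

(** * Orthogonal projections in a Hilbert space *)

Section HilbertSpace.
Variables (R : realType) (F : numFieldType) (theta : F -> F).
Variables (H : completeNormedModType F) (dot : {dot H for theta}).
Hypothesis norm_dot : forall x : H, `|x| ^+ 2 = dot x x.
(* The inclusion of the reals in the scalar field, for real and complex scalars alike. *)
Variable r : {rmorphism R -> F}.
Hypothesis r_le : {mono r : x y / x <= y}.
Hypothesis r_nneg : forall x : F, 0 <= x -> exists a, x = r a.
Hypothesis theta_r : forall a, theta (r a) = r a.
Implicit Types (x y z u v : H) (L G : set H).

Local Notation "''[' u , v ]" := (dot u v) : ring_scope.
Local Notation perp := (orthocompl dot).

Let theta0 : theta 0 = 0. Proof. by rewrite -(rmorph0 r) theta_r. Qed.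

Lemma hdotC u v : '[u, v] = theta '[v, u].
Proof. by rewrite (@hermitian_subproof _ _ _ _ dot) expr0 mul1r. Qed.

Lemma hdotC0 u v : '[u, v] = 0 -> '[v, u] = 0.
Proof. by move=> uv; rewrite hdotC uv theta0. Qed.

Lemma hdotBl u v w : '[u - v, w] = '[u, w] - '[v, w].
Proof. by rewrite linearBl. Qed.

Lemma hdotBr u v w : '[w, u - v] = '[w, u] - '[w, v].
Proof. by rewrite linearBr. Qed.

Lemma hdotDl u v w : '[u + v, w] = '[u, w] + '[v, w].
Proof. by rewrite linearDl. Qed.

Lemma hdotDr u v w : '[w, u + v] = '[w, u] + '[w, v].
Proof. by rewrite linearDr. Qed.

Lemma hdotZl c u w : '[c *: u, w] = c * '[u, w].
Proof. by rewrite linearZl_LR. Qed.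

Lemma hdotZr c u w : '[w, c *: u] = theta c * '[w, u].
Proof. exact: linearr_subproof. Qed.

Lemma hdot0l w : '[0, w] = 0. Proof. exact: linear0l. Qed.
Lemma hdot0r w : '[w, 0] = 0. Proof. exact: linear0r. Qed.

Lemma hdot_suml I (s : seq I) (P : pred I) (E : I -> H) w :
  '[\sum_(i <- s | P i) E i, w] = \sum_(i <- s | P i) '[E i, w].
Proof. exact: linear_sumlz. Qed.

Lemma hdot_sumr I (s : seq I) (P : pred I) (E : I -> H) w :
  '[w, \sum_(i <- s | P i) E i] = \sum_(i <- s | P i) '[w, E i].
Proof. exact: linear_sumr. Qed.

Lemma hdot_eq0 u : '[u, u] = 0 -> u = 0.
Proof. by rewrite -norm_dot => /eqP; rewrite sqrf_eq0 normr_eq0 => /eqP. Qed.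

Lemma pythagoras u v : '[u, v] = 0 -> `|u + v| ^+ 2 = `|u| ^+ 2 + `|v| ^+ 2.
Proof.
move=> uv; rewrite !norm_dot hdotDl !hdotDr uv (hdotC0 uv) addr0 add0r.
by [].
Qed.

Lemma norm_le_pythagoras u v : '[u, v] = 0 -> `|u| <= `|u + v|.
Proof.
move=> uv; rewrite -(ler_pXn2r (n := 2)) ?nnegrE // pythagoras //.
by rewrite lerDl exprn_ge0.
Qed.

Lemma parallelogram u v : `|u + v| ^+ 2 + `|u - v| ^+ 2 = (`|u| ^+ 2 + `|v| ^+ 2) *+ 2.
Proof. by rewrite !norm_dot !hdotDl !hdotDr !linearNl !linearNr /=; ring. Qed.

Lemma orth_component u x : exists c, '[u - c *: x, x] = 0.
Proof.
have [->|x0] := eqVneq x 0; first by exists 0; rewrite hdot0r.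
have xx : '[x, x] != 0 by apply: contraNneq x0 => /hdot_eq0/eqP.
by exists ('[u, x] / '[x, x]); rewrite hdotBl hdotZl divfK // subrr.
Qed.

(** If y is not orthogonal to x, with component c *: x along x, then by Pythagoras every
vector orthogonal to x has distance at least the norm of c *: x from y. *)
Lemma closed_orthocompl G : closed_subspace (perp G).
Proof.
split.
  split=> [|a u v]; rewrite !inE; first by move=> x _; rewrite hdot0l.
  by move=> uG vG x Gx; rewrite hdotDl hdotZl uG // vG // mulr0 addr0.
move=> y clGy x Gx.
have [c ycx] := orth_component y x.
suff cx0 : c *: x = 0 by rewrite -ycx cx0 subr0.
apply/eqP; rewrite -normr_eq0; apply/negP => /negP cx0.
have cx_gt0 : 0 < `|c *: x| by rewrite lt_def cx0 normr_ge0.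
have [z [Gz]] := clGy _ (nbhsx_ballx y _ cx_gt0).
rewrite -ball_normE /= => yz.
suff : `|c *: x| <= `|y - z| by move=> h; have := le_lt_trans h yz; rewrite ltxx.
have -> : y - z = c *: x + ((y - c *: x) - z) by rewrite addrA [c *: x + _]addrC subrK.
apply: norm_le_pythagoras; apply: hdotC0.
by rewrite hdotZr hdotBl ycx Gz // subrr mulr0.
Qed.

Lemma orthocompl_sub G x : G x -> perp (perp G) x.
Proof. by move=> Gx y yG; apply/hdotC0/yG. Qed.

Lemma closed_subspaceP L c u v : closed_subspace L -> L u -> L v -> L (c *: u + v).
Proof. by case=> -[_ LD] _ Lu Lv; have := LD c u v; rewrite !inE; apply. Qed.

Lemma closed_subspace0 L : closed_subspace L -> L 0.
Proof. by case=> -[L0 _] _; move: L0; rewrite inE. Qed.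

(** By the parallelogram identity a minimizing sequence for the distance from z to L is a
Cauchy sequence. Its limit p realizes the distance, so that z - p has no component along
any vector of L. *)
Lemma orthoproj_exists L z : closed_subspace L -> exists p, L p /\ perp L (z - p).
Proof.
move=> Lc; pose A := [set a : R | exists2 x, L x & `|z - x| = r a].
have A_ge0 a : A a -> 0 <= a.
  by case=> x _ xa; rewrite -r_le rmorph0 -xa.
have Ainf : has_inf A.
  split; last by exists 0 => a /A_ge0.
  have [a za] := r_nneg (normr_ge0 (z - 0)).
  by exists a; exists 0 => //; exact: closed_subspace0.
pose d := inf A.
have d0 : 0 <= d by apply: lb_le_inf => [|a /A_ge0]; [case: Ainf|].
have d_le x : L x -> r d <= `|z - x|.
  move=> Lx; have [a za] := r_nneg (normr_ge0 (z - x)).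
  by rewrite za r_le; apply: ge_inf; [case: Ainf|exists x].
pose e n : R := n.+1%:R^-1.
have e0 n : 0 < e n by rewrite invr_gt0.
have e1 n : e n <= 1 by rewrite invf_le1 // ler1n.
have e_dec m n : (m <= n)%N -> e n <= e m.
  by move=> mn; rewrite lef_pV2 ?posrE // ler_nat.
have /choice[x xP] n : exists x, L x /\ `|z - x| <= r (d + e n).
  have [a [x Lx xa] ad] := inf_adherent (e0 n) Ainf.
  by exists x; split=> //; rewrite xa r_le ltW.
have xL n : L (x n) by case: (xP n).
have xx m n : (m <= n)%N -> `|x m - x n| ^+ 2 <= r ((8 * d + 4) * e m).
  move=> mn; have := parallelogram (z - x n) (z - x m).
  have -> : z - x n - (z - x m) = x m - x n by rewrite opprB addrC addrA addrNK.
  have mid : r d *+ 2 <= `|z - x n + (z - x m)|.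
    have -> : z - x n + (z - x m) = (z - (2^-1 *: x n + 2^-1 *: x m)) *+ 2.
      rewrite -scalerDr -scaler_nat scalerBr scalerA divff ?pnatr_eq0 // scale1r.
      by rewrite scaler_nat opprD addrACA mulr2n.
    rewrite normrMn lerMn2r /=; apply: d_le.
    apply: closed_subspaceP => //; rewrite -[_ *: _]addr0.
    by apply: closed_subspaceP => //; exact: closed_subspace0.
  have le2 k : (m <= k)%N -> `|z - x k| ^+ 2 <= r ((d + e m) ^+ 2).
    move=> mk; rewrite rmorphXn ler_pXn2r ?nnegrE //; last first.
      by rewrite -(rmorph0 r) r_le addr_ge0 // ltW.
    case: (xP k) => _ h; apply: le_trans h _.
    by rewrite r_le lerD2l e_dec.
  have mid2 : r ((d *+ 2) ^+ 2) <= `|z - x n + (z - x m)| ^+ 2.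
    rewrite rmorphXn ler_pXn2r ?nnegrE //; first by rewrite rmorphMn.
    by rewrite -(rmorph0 r) r_le mulrn_wge0.
  move=> pl; have -> : `|x m - x n| ^+ 2 = (`|z - x n| ^+ 2 + `|z - x m| ^+ 2) *+ 2 -
    `|z - x n + (z - x m)| ^+ 2 by rewrite -pl addrAC subrr add0r.
  apply: (@le_trans _ _ (r (((d + e m) ^+ 2 + (d + e m) ^+ 2) *+ 2 - (d *+ 2) ^+ 2))).
    by rewrite rmorphB rmorphMn rmorphD; apply: lerB => //; rewrite lerMn2r /= lerD // le2.
  rewrite r_le; have := e1 m; have := e0 m; nra.
have x_cvg : cvgn x.
  apply: cauchy_cvg; apply: cauchy_exP => eps' eps'0.
  have [eps epsE] := r_nneg (ltW eps'0).
  move: eps'0; rewrite {eps'}epsE -{1}(rmorph0 r) (leW_mono r_le) => eps0.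
  have c0 : 0 <= 8 * d + 4 by lra.
  have eps20 : 0 < eps ^+ 2 / 2 by rewrite divr_gt0 // exprn_gt0.
  have [[//|m] _ hm] := archi_small c0 eps20.
  exists (x m); exists m => // n /= mn; rewrite -ball_normE /=.
  rewrite -(ltr_pXn2r (n := 2)) ?nnegrE //; last by rewrite -(rmorph0 r) r_le ltW.
  apply: le_lt_trans (xx _ _ mn) _.
  rewrite -rmorphXn (leW_mono r_le); apply: le_lt_trans hm _.
  by have := exprn_gt0 2 eps0; lra.
pose p := lim (x @ \oo).
have Lp : L p.
  case: Lc => _ Lcl; apply: (closed_cvg L Lcl _ p x_cvg).
  exact: nearW.
have zp : `|z - p| <= r d.
  have [a aE] := r_nneg (normr_ge0 (z - p)); rewrite aE r_le.
  apply/ler_addgt0Pr => eta eta0.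
  have eta20 : 0 < eta / 2 by lra.
  have [[//|m] _ hm] := archi_small ler01 eta20.
  have reta : 0 < r (eta / 2) by rewrite -(rmorph0 r) (leW_mono r_le).
  have /cvgrPdist_lt/(_ _ reta) [k _ hk] := x_cvg.
  pose n := maxn m k.
  rewrite -r_le -aE -(subrK (x n) z) -addrA; apply: le_trans (ler_normD _ _) _.
  have -> : r (d + eta) = r (d + eta / 2) + r (eta / 2).
    by rewrite -rmorphD; congr (r _); field.
  apply: lerD; last by rewrite distrC ltW // hk //= leq_maxr.
  case: (xP n) => _ /le_trans; apply; rewrite r_le lerD2l.
  by apply: le_trans hm; rewrite mul1r; apply: e_dec; exact: leq_maxl.
exists p; split => // y Ly.
have [c yc] := orth_component (z - p) y.
have cy0 : c *: y = 0.
  have := d_le (c *: y + p) (closed_subspaceP _ Lc Ly Lp).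
  have -> : z - (c *: y + p) = z - p - c *: y by rewrite opprD addrA addrAC.
  move=> zcy; have := pythagoras (u := z - p - c *: y) (v := c *: y).
  rewrite subrK hdotZr yc mulr0 => /(_ erefl) pyt.
  apply/eqP; rewrite -normr_eq0 -sqrf_eq0; apply/eqP/le_anti.
  rewrite exprn_ge0 // andbT -(lerD2l (`|z - p - c *: y| ^+ 2)) -pyt addr0.
  by rewrite ler_pXn2r ?nnegrE // (le_trans zp).
by move: yc; rewrite cy0 subr0.
Qed.

Lemma orthoprojP L z : closed_subspace L ->
  L (orthoproj dot L z) /\ perp L (z - orthoproj dot L z).
Proof. by move=> /(orthoproj_exists z); exact: xgetPex. Qed.

Lemma closed_subspaceB L u v : closed_subspace L -> L u -> L v -> L (u - v).
Proof.
by move=> Lc Lu Lv; rewrite addrC -scaleN1r; exact: closed_subspaceP.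
Qed.

Lemma orthoproj_eq L z p : closed_subspace L -> L p -> perp L (z - p) ->
  orthoproj dot L z = p.
Proof.
move=> Lc Lp zp; have [Lq zq] := orthoprojP z Lc; set q := orthoproj _ _ _ in Lq zq *.
have Lqp : L (q - p) by exact: closed_subspaceB.
apply/eqP; rewrite -subr_eq0; apply/eqP/hdot_eq0.
rewrite [X in '[X, _]](_ : _ = (z - p) - (z - q)); last first.
  by rewrite opprB [RHS]addrC addrA addrNK.
by rewrite hdotBl zp // zq // subrr.
Qed.

Lemma orthoproj_nonexpansive L x y : closed_subspace L ->
  `|orthoproj dot L x - orthoproj dot L y| <= `|x - y|.
Proof.
move=> Lc; have [Lp xp] := orthoprojP x Lc; have [Lq yq] := orthoprojP y Lc.
set p := orthoproj _ _ _ in Lp xp *; set q := orthoproj _ _ _ in Lq yq *.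
have -> : x - y = (p - q) + ((x - p) - (y - q)).
  by rewrite addrACA -opprD [p + _]addrC [q + _]addrC !subrK.
apply: norm_le_pythagoras; apply: hdotC0.
have Lpq : L (p - q) by exact: closed_subspaceB.
by rewrite hdotBl xp // yq // subrr.
Qed.

Lemma perp_perp_perp G u : perp G u -> perp (perp (perp G)) u.
Proof. exact: orthocompl_sub. Qed.

(** The double orthogonal complement of G is its closed span; this form of it lets
orthogonality be tested on the generators. *)
Lemma orthoproj_span G z p : perp (perp G) p -> perp G (z - p) ->
  orthoproj dot (perp (perp G)) z = p.
Proof.
by move=> Gp zp; apply: orthoproj_eq => //; [exact: closed_orthocompl|exact: perp_perp_perp].
Qed.

Lemma perp_perp_orthogonal G G' : (forall x y, G x -> G' y -> '[x, y] = 0) ->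
  forall x y, perp (perp G) x -> perp (perp G') y -> '[x, y] = 0.
Proof.
move=> GG' x y xG yG'; apply: xG => z Gz.
by apply: yG' => w G'w; exact: GG'.
Qed.

Section OrthonormalSequence.
Hypothesis infinite_dim : ~ finite_dimensional H.

Let on (l : seq H) := forall i j, (i < size l)%N -> (j < size l)%N ->
  '[l`_i, l`_j] = (i == j)%:R.

(** Gram and Schmidt: l does not span H. *)
Lemma orthonormal_extend (l : seq H) : on l ->
  exists u, '[u, u] = 1 /\ forall i, (i < size l)%N -> '[u, l`_i] = 0.
Proof.
move=> l_on.
have [x xN] : exists x, x - \sum_(i < size l) '[x, l`_i] *: l`_i != 0.
  apply: contra_notP infinite_dim => nx; exists (size l), (fun i => l`_i) => x.
  exists (fun i => '[x, l`_i]); apply/eqP; rewrite -subr_eq0.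
  by apply: contra_notT nx => xn; exists x.
set v := x - _ in xN.
have vl j : (j < size l)%N -> '[v, l`_j] = 0.
  move=> jl; rewrite hdotBl hdot_suml (sum_ord_single jl) => [|i ij]; rewrite hdotZl l_on //.
    by rewrite eqxx mulr1 subrr.
  by rewrite (negPf ij) mulr0.
have [a va] := r_nneg (normr_ge0 v).
have a0 : a != 0 by apply: contraNneq xN => a0; rewrite -normr_eq0 va a0 rmorph0.
exists (r a^-1 *: v); split=> [|i il]; last by rewrite hdotZl vl // mulr0.
rewrite hdotZl hdotZr theta_r -norm_dot va -rmorphXn -!rmorphM -(rmorph1 r); congr (r _).
by field.
Qed.

Lemma orthonormal_sequence : exists b : nat -> H, forall i j, '[b i, b j] = (i == j)%:R.
Proof.
have /choice[f fP] (l : seq H) : exists u, on l ->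
    '[u, u] = 1 /\ forall i, (i < size l)%N -> '[u, l`_i] = 0.
  have [/orthonormal_extend[u uP]|nl] := pselect (on l); first by exists u.
  by exists 0.
pose L n := iter n (fun l => rcons l (f l)) [::].
pose b n := f (L n).
have szL n : size (L n) = n by elim: n => [//|n IH]; rewrite /= size_rcons IH.
have nthL n i : (i < n)%N -> (L n)`_i = b i.
  elim: n => [//|n IH]; rewrite ltnS leq_eqVlt /= nth_rcons szL => /predU1P[->|i_n].
    by rewrite ltnn eqxx.
  by rewrite i_n IH.
have onL n : on (L n).
  elim: n => [//|n IH] i j; rewrite szL !ltnS => i_n j_n.
  have [bb bl] := fP _ IH; rewrite szL in bl.
  have bn k : (k < n)%N -> '[b n, b k] = 0 by move=> kn; rewrite -(nthL n k) //; exact: bl.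
  rewrite !nthL //; move: i_n j_n; rewrite (leq_eqVlt i) (leq_eqVlt j).
  move=> /predU1P[->|i_n] /predU1P[->|j_n].
  - by rewrite eqxx.
  - by rewrite bn // gtn_eqF.
  - by rewrite hdotC0 ?bn // ltn_eqF.
  - by rewrite -(nthL n i) // -(nthL n j) // IH ?szL.
exists b => i j; pose n := (maxn i j).+1.
have i_n : (i < n)%N by rewrite ltnS leq_maxl.
have j_n : (j < n)%N by rewrite ltnS leq_maxr.
by rewrite -(nthL n i) // -(nthL n j) // onL ?szL.
Qed.

End OrthonormalSequence.

(** The isometry that sends the standard basis of the finite real sequences to c. *)
Definition embed (c : nat -> H) (p : {poly R}) : H := \sum_(i < size p) r p`_i *: c i.

Lemma embedE c n (p : {poly R}) : (size p <= n)%N -> embed c p = \sum_(i < n) r p`_i *: c i.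
Proof.
move=> pn; rewrite /embed (big_ord_widen _ (fun i => r p`_i *: c i) pn) big_mkcond.
apply: eq_bigr => i _; case: ltnP => // pi.
by rewrite nth_default // rmorph0 scale0r.
Qed.

Lemma embedB c (p q : {poly R}) : embed c (p - q) = embed c p - embed c q.
Proof.
pose n := maxn (size (p - q)) (maxn (size p) (size q)).
rewrite (@embedE c n) ?leq_maxl // (@embedE c n p) ?(@embedE c n q); last 2 first.
- by rewrite /n !leq_max leqnn !orbT.
- by rewrite /n !leq_max leqnn !orbT.
by rewrite -sumrB; apply: eq_bigr => i _; rewrite coefB rmorphB scalerBl.
Qed.

Lemma embed_Xn c i : embed c 'X^i = c i.
Proof.
rewrite /embed size_polyXn (sum_ord_single (ltnSn i)) => [|k ki]; rewrite coefXn.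
  by rewrite eqxx rmorph1 scale1r.
by rewrite (negPf ki) rmorph0 scale0r.
Qed.

Lemma dot_embed_orthogonal c c1 (p q : {poly R}) :
  (forall i j, p`_i != 0 -> '[c i, c1 j] = 0) -> '[embed c p, embed c1 q] = 0.
Proof.
move=> cc1; rewrite hdot_suml big1 // => i _; rewrite hdot_sumr big1 // => j _.
rewrite hdotZl hdotZr; have [->|/cc1->] := eqVneq p`_i 0; last by rewrite !mulr0.
by rewrite rmorph0 mul0r.
Qed.

Lemma dot_embed c (p q : {poly R}) : (forall i j, '[c i, c j] = (i == j)%:R) ->
  '[embed c p, embed c q] = r (dotp p q).
Proof.
move=> c_on; rewrite (dotpE _ (leq_maxl (size p) (size q))).
rewrite (embedE _ (leq_maxl (size p) (size q))) (embedE _ (leq_maxr (size p) (size q))).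
set n := maxn _ _; rewrite rmorph_sum hdot_suml; apply: eq_bigr => i _.
rewrite hdot_sumr (bigD1 i) //= big1 => [|j ji].
  by rewrite hdotZl hdotZr theta_r c_on eqxx mulr1 addr0 rmorphM.
by rewrite hdotZl hdotZr c_on eq_sym val_eqE (negPf ji) !mulr0.
Qed.

Lemma norm_embed c (p : {poly R}) : (forall i j, '[c i, c j] = (i == j)%:R) ->
  `|embed c p| = r (nrm (@dotp R) p).
Proof.
move=> c_on; apply/eqP; rewrite -(eqrXn2 (n := 2)) //; last first.
  by rewrite -(rmorph0 r) r_le nrm_ge0.
by rewrite norm_dot dot_embed // -rmorphXn sqr_nrm.
Qed.

(** * Gluing the blocks *)

Variable K : nat.
Hypothesis K_ge5 : (5 <= K)%N.

(** The class of the block i, which selects the subspace that contains its Y. Blocks of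
the same class are not neighbours, and neither are blocks of two nonzero classes. *)
Definition color i := if odd i then 0%N else (i./2 %% (K - 3)).+1.

(** The number of the subspace that acts in the block i as the letter l. *)
Definition space_index i l := if (l < 2)%N then l else (2 + color i)%N.

Lemma space_index_lt i l : (space_index i l < K)%N.
Proof.
rewrite /space_index /color; case: (ltnP l 2) => [|_]; first by lia.
case: ifP => _; first by lia.
have K3 : (0 < K - 3)%N by lia.
by have := ltn_pmod i./2 K3; lia.
Qed.

Lemma same_color i k : color i = color k -> i <> k -> (i.+1 < k)%N || (k.+1 < i)%N.
Proof. by rewrite /color; case: ifP; case: ifP; lia. Qed.

Lemma even_color i k : (0 < color i)%N -> (0 < color k)%N -> i <> k ->
  (i.+1 < k)%N || (k.+1 < i)%N.
Proof. by rewrite /color; case: ifP; case: ifP; lia. Qed.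

Lemma color_recurs c N : (c < K - 2)%N -> exists2 i, (N <= i)%N & color i = c.
Proof.
case: c => [|c] cK.
  by exists N.*2.+1; [lia|rewrite /color /= odd_double].
exists (N * (K - 3) + c).*2; first by nia.
by rewrite /color odd_double doubleK modnMDl modn_small //; lia.
Qed.

Lemma space_index_recurs k N : (k < K)%N ->
  exists i l, [/\ (N <= i)%N, (l < 3)%N & space_index i l = k].
Proof.
case: k => [|[|k]] kK; [by exists N, 0%N|by exists N, 1%N|].
have [|i Ni ik] := @color_recurs k N; first by lia.
by exists i, 2%N; rewrite /space_index ik.
Qed.

(** Basis of the block i: e_i and e_(i+1), which have even numbers, followed by private
vectors, which have odd numbers. *)
Definition frame_index i m := match m with
  | 0 => i.*2 | 1 => i.+1.*2 | m'.+2 => (pickle (i, m')).*2.+1 end.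

Lemma frame_index_inj i m m' : frame_index i m = frame_index i m' -> m = m'.
Proof.
case: m => [|[|m]]; case: m' => [|[|m']] //=; try lia.
move=> h; have /(pcan_inj pickleK)[-> //] : pickle (i, m) = pickle (i, m') by lia.
Qed.

Lemma frame_index_aux i k m m' : i <> k -> frame_index i m.+2 <> frame_index k m'.
Proof.
move=> ik; case: m' => [|[|m']] /=; try lia.
by move=> h; have /(pcan_inj pickleK)[] : pickle (i, m) = pickle (k, m') by lia.
Qed.

Lemma frame_index_far i k m m' : (i.+1 < k)%N || (k.+1 < i)%N ->
  frame_index i m <> frame_index k m'.
Proof.
move=> ik; case: m => [|[|m]]; case: m' => [|[|m']] /=; try lia.
move=> h; have /(pcan_inj pickleK)[ik' _] : pickle (i, m) = pickle (k, m') by lia.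
by move: ik; rewrite ik'; lia.
Qed.

Section Frames.
Variable b : nat -> H.
Hypothesis b_on : forall i j, '[b i, b j] = (i == j)%:R.

Definition frame i m := b (frame_index i m).

Lemma frame_on i m m' : '[frame i m, frame i m'] = (m == m')%:R.
Proof.
rewrite b_on; congr ((nat_of_bool _)%:R).
by apply/eqP/eqP => [/frame_index_inj|->].
Qed.

Lemma frame_orthogonal i k m m' : frame_index i m <> frame_index k m' ->
  '[frame i m, frame k m'] = 0.
Proof. by move=> /eqP/negPf im; rewrite b_on im. Qed.

Variables (P : nat -> nat -> {poly R} -> {poly R}) (s : nat -> seq nat).
Hypothesis P_proj : forall i l, projector (@dotp R) (P i l).
Hypothesis P_fix : forall i l j, (l < 2)%N -> (j < 2)%N -> P i l 'X^j = 'X^j.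
Hypothesis s_mem : forall i l, (l \in s i) = (l < 3)%N.

Definition generators (k : nat) : set H :=
  [set x | exists i l p, [/\ (l < 3)%N, space_index i l = k & x = embed (frame i) (P i l p)]].

Definition space k := perp (perp (generators k)).

Lemma space_closed k : closed_subspace (space k).
Proof. exact: closed_orthocompl. Qed.

(** If l < 2, then p - P i l p has no component along e_i and e_(i+1), because these
vectors are in the range of P i l; the other basis vectors are private to the block i.
If l = 2, then different blocks i and k of the same class have no basis vector in
common. *)
Lemma residual_orthogonal i k l l' p p' : (l < 3)%N -> (l' < 3)%N ->
  space_index i l = space_index k l' ->
  '[embed (frame i) (p - P i l p), embed (frame k) (P k l' p')] = 0.
Proof.
move=> l3 l'3 ll'.
have [ik|/eqP ik] := eqVneq i k.
  subst k; have <- : l = l'.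
    by move: ll'; rewrite /space_index; case: (ltnP l 2); case: (ltnP l' 2); lia.
  by rewrite dot_embed //; [rewrite P_proj rmorph0|exact: frame_on].
apply: dot_embed_orthogonal => // m m' pm; apply: frame_orthogonal.
have [l2|l2] := ltnP l 2.
  case: m pm => [|[|m]]; last by move=> _; exact: frame_index_aux.
    by rewrite -dotp_coef -(P_fix i l2 (isT : 0 < 2)%N) P_proj eqxx.
  by rewrite -dotp_coef -(P_fix i l2 (isT : 1 < 2)%N) P_proj eqxx.
apply: frame_index_far; apply: same_color => //.
by move: ll'; rewrite /space_index; case: (ltnP l 2); case: (ltnP l' 2); lia.
Qed.

(** The glued subspaces act in each block as the projections of that block. *)
Lemma orthoproj_embed i l p : (l < 3)%N ->
  orthoproj dot (space (space_index i l)) (embed (frame i) p) = embed (frame i) (P i l p).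
Proof.
move=> l3; apply: orthoproj_span => //.
  by apply: orthocompl_sub => //; exists i, l, p.
move=> _ [k [l' [p' [l'3 kl' ->]]]]; rewrite -embedB.
exact: residual_orthogonal.
Qed.

Lemma space_orthogonal k k' : (3 <= k)%N -> (3 <= k')%N -> k <> k' ->
  forall x y, space k x -> space k' y -> '[x, y] = 0.
Proof.
move=> k3 k'3 kk'; apply: perp_perp_orthogonal => _ _
  [i [l [p [l3 ik ->]]]] [j [l' [q [l'3 jk' ->]]]].
apply: dot_embed_orthogonal => // m m' _; apply/frame_orthogonal/frame_index_far.
move: ik jk'; rewrite /space_index; case: (ltnP l 2) => l2; case: (ltnP l' 2) => l'2; try lia.
by move=> ik jk'; apply: even_color; [lia|lia|move=> ij; subst j; lia].
Qed.

Definition word i := map (space_index i) (s i).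

Definition run z w := foldl (fun z k => orthoproj dot (space k) z) z w.

Lemma run_nonexpansive w x y : `|run x w - run y w| <= `|x - y|.
Proof.
elim: w x y => [//|k w IH] x y /=; apply: le_trans (IH _ _) _.
by apply: orthoproj_nonexpansive; exact: space_closed.
Qed.

Lemma run_word i p :
  run (embed (frame i) p) (word i) = embed (frame i) (foldl (fun q l => P i l q) p (s i)).
Proof.
have : all (fun l => l < 3)%N (s i) by apply/allP => l; rewrite s_mem.
rewrite /run /word; elim: (s i) p => [//|l w IH] p /= /andP[l3 w3].
by rewrite orthoproj_embed // IH.
Qed.

Lemma proj_iterates_run ks z n : proj_iterates dot space ks z n = run z (mkseq ks n).
Proof. by elim: n => [//|n IH]; rewrite mkseqS /run foldl_rcons /= IH. Qed.

Hypothesis s_transfer : forall i,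
  nrm (@dotp R) (foldl (fun q l => P i l q) 'X^0 (s i) - 'X^1) <= 8^-1 * 2^-1 ^+ i.

(** In the block m the transfer adds an error of at most 1/8 * (1/2)^m, and the error
already present does not grow. *)
Lemma embed_near m : `|run (frame 0 0) (concat word m) - frame m 0|
  <= r (4^-1 * (1 - 2^-1 ^+ m)).
Proof.
elim: m => [|m IH]; first by rewrite /= subrr normr0 expr0 subrr mulr0 rmorph0.
have -> : frame m.+1 0 = embed (frame m) 'X^1 by rewrite embed_Xn.
rewrite concatS /run foldl_cat -/(run _ _) -/(run _ (word m)).
set x := run _ (concat word m) in IH *.
rewrite -(subrK (run (frame m 0) (word m)) (run x (word m))) -addrA.
apply: le_trans (ler_normD _ _) _.
have -> : r (4^-1 * (1 - 2^-1 ^+ m.+1)) =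
    r (4^-1 * (1 - 2^-1 ^+ m)) + r (8^-1 * 2^-1 ^+ m).
  by rewrite -rmorphD exprS; congr (r _); field.
apply: lerD; first exact: le_trans (run_nonexpansive _ _ _) IH.
have -> : frame m 0 = embed (frame m) 'X^0 by rewrite embed_Xn.
by rewrite run_word -embedB norm_embed ?r_le //; exact: frame_on.
Qed.

(** Beyond some index the iterates would stay within 1/8 of their limit, so that two
consecutive vectors e_n would have distance at most 3/4; their distance is the square
root of 2. *)
Lemma divergence ks : (forall m, mkseq ks (size (concat word m)) = concat word m) ->
  ~ cvgn (proj_iterates dot space ks (frame 0 0)).
Proof.
move=> ksE x_cvg; have r8 : 0 < r 8^-1 by rewrite -(rmorph0 r) (leW_mono r_le).
have s_gt0 i : (0 < size (word i))%N.
  by rewrite size_map; have := s_mem i 0; case: (s i).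
have /cvgrPdist_lt/(_ _ r8) [n _ xn] := x_cvg; set x := lim _ in xn.
have near m : (n <= m)%N -> `|x - frame m 0| <= r (3 / 8).
  move=> nm; rewrite -(subrK (run (frame 0 0) (concat word m)) x) -addrA.
  apply: le_trans (ler_normD _ _) _.
  rewrite (_ : 3 / 8 = 8^-1 + 4^-1 :> R); last by field.
  rewrite rmorphD; apply: lerD.
    rewrite -ksE -proj_iterates_run; apply/ltW/xn => /=.
    exact: leq_trans nm (size_concat s_gt0 m).
  apply: le_trans (embed_near m) _; rewrite r_le.
  by have : 0 <= (2^-1 : R) ^+ m; [rewrite exprn_ge0 // invr_ge0|lra].
have : `|frame n 0 - frame n 1| <= r (3 / 4).
  rewrite -(subrK x (frame n 0)) -addrA; apply: le_trans (ler_normD _ _) _.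
  rewrite (_ : 3 / 4 = 3 / 8 + 3 / 8 :> R); last by field.
  by rewrite rmorphD distrC lerD ?near //; exact: (near n.+1 (leqnSn n)).
rewrite -(ler_pXn2r (n := 2)) ?nnegrE //; last by rewrite -(rmorph0 r) r_le; lra.
rewrite norm_dot hdotBl !hdotBr !frame_on /= subr0 sub0r opprK.
rewrite -rmorphXn -(rmorph1 r) -rmorphD r_le; lra.
Qed.

End Frames.

Lemma divergent_projections : ~ finite_dimensional H ->
  exists L : 'I_K -> set H,
    [/\ forall i : 'I_K, closed_subspace (L i),
        \bigcap_i L i = [set 0],
        exists (z0 : H) (k : nat -> 'I_K),
          (forall i : 'I_K, infinite_set [set n | k n = i]) /\
          ~ cvgn (proj_iterates dot L k z0),
        forall i j : 'I_K, (3 <= i)%N -> (3 <= j)%N -> i != j ->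
          forall x y : H, L i x -> L j y -> dot x y = 0
      & set_sum (fun i => orthocompl dot (L i)) = [set: H]].
Proof.
move=> /orthonormal_sequence[b b_on].
have eps_gt0 i : 0 < 8^-1 * (2^-1 : R) ^+ i.
  by rewrite mulr_gt0 ?invr_gt0 ?exprn_gt0 ?invr_gt0.
have /choice[P /choice[s Ps]] i := transfer_word (@dotp_Xn R) (eps_gt0 i).
have P_proj i l : projector (@dotp R) (P i l) by case: (Ps i).
have P_fix i l j : (l < 2)%N -> (j < 2)%N -> P i l 'X^j = 'X^j.
  by case: (Ps i) => _ + _ _; apply.
have s_mem i l : (l \in s i) = (l < 3)%N by case: (Ps i).
pose L k := space b P k.
have Lc k : closed_subspace (L k) by exact: space_closed.
have L_orth k k' := @space_orthogonal b b_on P k k'.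
have K3 : (3 < K)%N by lia.
have K4 : (4 < K)%N by lia.
exists (fun i => L i); split => //.
- apply/seteqP; split=> [x xL|x -> i _]; last exact: closed_subspace0.
  have x3 : L 3 x by exact: (xL (Ordinal K3)).
  have x4 : L 4 x by exact: (xL (Ordinal K4)).
  by apply: hdot_eq0; exact: (L_orth 3 4).
- have word_gt0 i : (0 < size (word s i))%N.
    by rewrite size_map; have := s_mem i 0; case: (s i).
  have [ks ksE] := concat_sequence word_gt0.
  have ks_at i l : (l < 3)%N -> exists2 n, (i <= n)%N & ks n = space_index i l.
    rewrite -(s_mem i) => ls.
    have lw : space_index i l \in word s i by exact: map_f.
    exists (size (concat (word s) i) + index (space_index i l) (word s i))%N.
      by apply: leq_trans (size_concat word_gt0 i) _; exact: leq_addr.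
    have := ksE i.+1; rewrite concatS.
    move=> /(congr1 (fun w => nth 0%N w (size (concat (word s) i)
      + index (space_index i l) (word s i)))).
    rewrite nth_mkseq ?size_cat ?ltn_add2l ?index_mem // => ->.
    by rewrite nth_cat ltnNge leq_addr /= addKn nth_index.
  have ks_lt n : (ks n < K)%N.
    have : ks n \in concat (word s) n.+1.
      by rewrite -ksE map_f // mem_iota /= add0n; exact: size_concat.
    by case/flattenP => _ /mapP[i _ ->] /mapP[l _ ->]; exact: space_index_lt.
  exists (frame b 0 0), (fun n => Ordinal (ks_lt n)); split=> [i|].
    apply: unbounded_infinite_set => N.
    have [j [l [Nj l3 jl]]] := space_index_recurs N (ltn_ord i).
    have [n jn nE] := ks_at j l l3.
    exists n; first exact: leq_trans jn.
    by apply: val_inj; rewrite /= nE.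
  rewrite (_ : proj_iterates _ _ _ _ = proj_iterates dot L ks (frame b 0 0)).
    by apply: divergence => // i; case: (Ps i).
  by apply/funext; elim => [//|n IH] /=; rewrite IH.
- by move=> i j i3 j3 /eqP ij x y; apply: L_orth => // /val_inj.
- apply/seteqP; split=> // x _.
  have [Lp xp] := orthoprojP x (Lc 3); set p := orthoproj _ _ _ in Lp xp.
  exists (fun i : 'I_K => if val i == 3 then x - p else if val i == 4 then p else 0).
    move=> i; case: eqP => [->//|_]; case: eqP => [->|_] y Ly; last exact: hdot0l.
    exact: (L_orth 3 4).
  rewrite (bigD1 (Ordinal K3)) //= (bigD1 (Ordinal K4)) //= big1 ?addr0 ?subrK // => i.
  move=> /andP[i3 i4]; case: eqP => [e|_]; first by case/eqP: i3; apply: val_inj.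
  by case: eqP => // e; case/eqP: i4; apply: val_inj.
Qed.

End HilbertSpace.

(* The subspaces L_1, ..., L_K are L i for i = 0, ..., K - 1, i.e. L_{i+1} is L i;
   thus L_4, ..., L_K are the L i with 3 <= i. *)
Theorem mainTheorem6 (R : realType) (s : scalars)
    (H : completeNormedModType (scalar_field R s))
    (dot : {dot H for @scalar_conj R s})
    (norm_dot : forall x : H, `|x| ^+ 2 = dot x x)
    (infinite_dim : ~ finite_dimensional H)
    (K : nat) (K_ge5 : (5 <= K)%N) :
  exists L : 'I_K -> set H,
    [/\ forall i : 'I_K, closed_subspace (L i),
        \bigcap_i L i = [set 0],
        exists (z0 : H) (k : nat -> 'I_K),
          (forall i : 'I_K, infinite_set [set n | k n = i]) /\
          ~ cvgn (proj_iterates dot L k z0),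
        forall i j : 'I_K, (3 <= i)%N -> (3 <= j)%N -> i != j ->
          forall x y : H, L i x -> L j y -> dot x y = 0
      & set_sum (fun i => orthocompl dot (L i)) = [set: H]].
Proof.
case: s H dot norm_dot infinite_dim => H dot norm_dot infinite_dim.
  apply: (@divergent_projections R R id H dot norm_dot idfun) => // x _.
  by exists x.
apply: (@divergent_projections R R[i] (@conjc R) H dot norm_dot (real_complex R)) => //.
- exact: lecR.
- case=> a c; rewrite lecE /= => /andP[/eqP -> _].
  by exists a.
- by move=> a; rewrite /= oppr0.
Qed.
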